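(* Let $f(q)=\sum_{k=0}^{n} c_k q^k$ be a nonzero polynomial with nonnegative integer coefficients. The following are equivalent: (i) every complex root of $f$ is either a root of unity or $0$; (ii) every complex root of $f$ has modulus at most $1$, and the leading coefficient of $f$ equals the greatest common divisor of all coefficients of $f$; (iii) $f$ is a positive integer times a product of cyclotomic polynomials and factors of $q$; (iv) there are multisets $\{a_1,\ldots,a_m\}$ and $\{b_1,\ldots,b_m\}$ of positive integers and integers $\alpha\in\mathbb{Z}_{>0}$, $\beta\in\mathbb{Z}_{\geq 0}$ such that \[ f(q)=\alpha q^{\beta}\prod_{j=1}^m \frac{[a_j]_q}{[b_j]_q}=\alpha q^\beta\prod_{j=1}^m\frac{1-q^{a_j}}{1-q^{b_j}}; \] (v) letting $\mathcal{X}$ be the discrete random variable with $P(\mathcal{X}=k)=c_k/f(1)$ and $\beta$ the largest integer with $q^\beta\mid f(q)$, there are multisets $\{a_1,\ldots,a_m\}$, $\{b_1,\ldots,b_m\}$ of positive integers such that the equality in distribution \[ \mathcal{X}+\mathcal{U}_{b_1}+\cdots+\mathcal{U}_{b_m} = \beta+\mathcal{U}_{a_1}+\cdots+\mathcal{U}_{a_m} \] holds, where all summands are independent; (vi) there is a discrete random variable $\mathcal{X}$ on a uniform sample space, supported on $\mathbb{Z}_{\geq 0}$, with probability generating function $\mathbb{E}[q^{\mathcal{X}}]=f(q)/f(1)$, such that the function $\phi_{\mathcal{X}}(z):=\mathbb{E}[e^{2\pi i z\mathcal{X}}]$ has complex zeros only at rational numbers $z\in\mathbb{Q}$. Moreover,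 in (iv) the factorization is unique if the two multisets are required to be disjoint.
   Context: For a positive integer $n$, $[n]_q:=1+q+\cdots+q^{n-1}=(1-q^n)/(1-q)$ is the $q$-integer. The $n$th cyclotomic polynomial is $\Phi_n(q)=\prod_{1\le k\le n,\ \gcd(k,n)=1}(q-e^{2\pi i k/n})$. For a positive integer $a$, $\mathcal{U}_a$ denotes a random variable uniformly distributed on $\{0,1,\ldots,a-1\}$. A polynomial satisfying these equivalent conditions is called a cyclotomic generating function (CGF). *)

(* Defs.v *)
From HB Require Import structures.
From mathcomp Require Import all_boot all_order all_algebra all_field.
From mathcomp Require Import complex.
From mathcomp Require Import all_classical all_reals all_analysis.

Set Implicit Arguments.
Unset Strict Implicit.
Unset Printing Implicit Defensive.

Import Order.TTheory GRing.Theory Num.Theory.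
Local Open Scope classical_set_scope.
Local Open Scope complex_scope.
Local Open Scope ring_scope.

Local Notation "x %:F" := (@FracField.tofrac _ x) : ring_scope.

Definition qint (n : nat) : {poly int} := \sum_(i < n) 'X^i.

(* The quotients live in the field of fractions of Z[q], where the two products
   need not be polynomials. The multisets are tuples up to [perm_eq]. *)
Definition qint_factorization (f : {poly int}) (alpha beta m : nat)
    (a b : m.-tuple nat) : Prop :=
  [/\ (0 < alpha)%N,
      {in a, forall x, 0 < x}%N,
      {in b, forall x, 0 < x}%N,
      f%:F = (alpha%:R * 'X^beta)%:F *
             \prod_(j < m) ((qint (tnth a j))%:F / (qint (tnth b j))%:F)
    & f%:F = (alpha%:R * 'X^beta)%:F *
             \prod_(j < m) ((1 - 'X^(tnth a j))%:F / (1 - 'X^(tnth b j))%:F)].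

Definition disjoint_multisets (a b : seq nat) : Prop :=
  {in a, forall x, x \notin b}.

Definition mutually_independent d d' (T : measurableType d)
    (T' : measurableType d') (R : realType) (P : probability T R) (I : finType)
    (Y : I -> {RV P >-> T'}) : Prop :=
  forall (J : {set I}) (B : I -> set T'),
    (forall i, measurable (B i)) ->
    P (\bigcap_(i in [set i | i \in J]) Y i @^-1` B i) =
    (\prod_(i in J) P (Y i @^-1` B i))%E.

Definition uniformly_distributed d (T : measurableType d) (R : realType)
    (P : probability T R) (a : nat) (U : {RV P >-> nat}) : Prop :=
  forall k : nat,
    P (U @^-1` [set k]) = (if (k < a)%N then a%:R^-1 else 0 : R)%:E.

Definition join_family (A : Type) (m : nat) (X : A) (U V : 'I_m -> A)
    (s : option ('I_m + 'I_m)) : A :=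
  match s with
  | None => X
  | Some (inl j) => U j
  | Some (inr j) => V j
  end.

(* Divisibility by the monic polynomial 'X^k is genuine divisibility in Z[q],
   although [%|] is pseudo-divisibility in general. *)
Definition largest_X_power (f : {poly int}) (beta : nat) : Prop :=
  'X^beta %| f /\ forall k : nat, 'X^k %| f -> (k <= beta)%N.

Definition unif_expectation (R : realType) (Omega : finType)
    (Y : Omega -> R[i]) : R[i] :=
  (\sum_(w : Omega) Y w) / #|Omega|%:R.

Definition cexp (R : realType) (z : R[i]) : R[i] :=
  (expR (complex.Re z) * cos (complex.Im z)) +i*
  (expR (complex.Re z) * sin (complex.Im z)).

Definition char_fun (R : realType) (Omega : finType) (X : Omega -> nat)
    (z : R[i]) : R[i] :=
  unif_expectation (fun w => cexp ((0 +i* (2 * pi)) * z * (X w)%:R)).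

(* Main.v *)
Require Import Defs.
From HB Require Import structures.
From mathcomp Require Import all_boot all_order all_algebra all_field.
From mathcomp Require Import complex zify ring.
From mathcomp Require Import all_classical all_reals all_analysis.

Set Implicit Arguments.
Unset Strict Implicit.
Unset Printing Implicit Defensive.

Import Order.TTheory GRing.Theory Num.Theory.
Local Open Scope classical_set_scope.
Local Open Scope complex_scope.
Local Open Scope ring_scope.

(** The statement turns on polynomial identities in Z[q]. If every nonzero root
    of [f] is a root of unity, irreducibility of the cyclotomic polynomials lets
    one split them off one by one; under (ii) the monic quotient of [f] by its
    content has this property by Kronecker's theorem. Since [f.[1] > 0], the
    factor [Phi_1] does not occur, and for [n > 1] the relation
    [prod_(d | n) Phi_d = X^n - 1] writes [Phi_n] recursively as a quotient of
    two equally long products of [1 - X^a]. Conversely (iv) says that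
    [f * prod_j [b_j] = alpha X^beta prod_j [a_j]]; dividing both sides by their
    values at 1 gives an identity between probability generating functions,
    which is (v) read on the laws of independent sums. It shows that the nonzero
    roots of [f] are roots of unity. Finally [phi_X(z) = f(e^(2 i pi z)) / f(1)],
    and [e^(2 i pi z)] is a root of unity exactly when [z] is rational. *)

(** * Kronecker's theorem *)

Section Kronecker.
Variable C : numClosedFieldType.

Lemma char_poly_conj (n : nat) (P A : 'M[C]_n) :
  P \in unitmx -> char_poly (P *m A *m invmx P) = char_poly A.
Proof.
move=> Pu; rewrite /char_poly.
have -> : char_poly_mx (P *m A *m invmx P) =
    map_mx polyC P *m char_poly_mx A *m map_mx polyC (invmx P).
  rewrite /char_poly_mx mulmxBr mulmxBl !map_mxM /=; congr (_ - _).
  by rewrite scalar_mxC -mulmxA -map_mxM mulmxV // map_mx1 mulmx1.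
by rewrite !det_mulmx mulrAC -det_mulmx -map_mxM mulmxV // map_mx1 det1 mul1r.
Qed.

Lemma trig_mulmx (n : nat) (A B : 'M[C]_n) :
  is_trig_mx A -> is_trig_mx B ->
  is_trig_mx (A *m B) /\ forall i, (A *m B) i i = A i i * B i i.
Proof.
move=> /is_trig_mxP tA /is_trig_mxP tB; split.
  apply/is_trig_mxP => i j lt_ij; rewrite mxE big1 // => k _.
  have [lt_ik|le_ki] := ltnP i k; first by rewrite tA ?mul0r.
  by rewrite tB ?mulr0 // (leq_ltn_trans le_ki).
move=> i; rewrite mxE (bigD1 i) //= big1 ?addr0 // => k ne_ki.
have [lt_ik|le_ki] := ltnP i k; first by rewrite tA ?mul0r.
by rewrite tB ?mulr0 // ltn_neqAle le_ki andbT.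
Qed.

(** The [d i] are the eigenvalues of the companion matrix [M] of [g]. Schur's theorem conjugates [M]
    over [C] to a triangular [T] with diagonal [d], so the power sums are the traces of the powers
    of [T], hence of the integer matrix [M]. *)
Lemma power_sums_int (g : {poly int}) : g \is monic ->
  exists (n : nat) (d : 'I_n -> C),
    map_poly intr g = \prod_(i < n) ('X - (d i)%:P) /\
    forall k, exists t : int, \sum_(i < n) d i ^+ k = t%:~R.
Proof.
move=> mg; pose n := (size g).-1; pose M : 'M[int]_n := companionmx g.
(* Schur triangularization asks for a matrix of positive size. *)
case: (posnP n) => [n0|n_gt0].
  have g1 : g = 1.
    have /size1_polyC gE : (size g <= 1)%N by rewrite -subn_eq0 subn1 -/n n0.
    by move: mg; rewrite gE monicE lead_coefC => /eqP ->.
  exists 0%N, (fun=> 0); rewrite g1 rmorph1 big_ord0; split=> // k.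
  by exists 0; rewrite big_ord0.
pose A : 'M[C]_n := map_mx intr M.
have [P Pu tPA] := Schur A n_gt0.
have {}Pu := unitarymx_unit Pu.
have {tPA} := tPA.
rewrite /similar_to /= conjumx // => trigT.
pose T := P *m A *m invmx P.
exists n, (fun i => T i i); split.
  rewrite -(char_poly_trig trigT) char_poly_conj // -(companionmxK mg) -/M.
  by rewrite map_char_poly.
move=> k; pose pw (R : comPzRingType) (B : 'M[R]_n) k := iter k (mulmx B) 1%:M.
have pwT j : is_trig_mx (pw _ T j) /\ forall i, (pw _ T j) i i = T i i ^+ j.
  elim: j => [|j [tj IH]].
    by split=> [|i]; rewrite ?scalar_mx_is_trig //= mxE eqxx expr0.
  have [t1 d1] := trig_mulmx trigT tj; split=> // i.
  by rewrite /pw iterS d1 -/(pw _ _ _) IH exprS.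
have pwP j : pw _ T j = P *m pw _ A j *m invmx P.
  elim: j => [|j IH]; first by rewrite /= mulmx1 mulmxV.
  by rewrite /pw !iterS -/(pw _ _ _) IH !mulmxA mulmxKV.
have pwM j : pw _ A j = map_mx intr (pw _ M j).
  elim: j => [|j IH]; first by rewrite /= map_mx1.
  by rewrite /pw !iterS -/(pw _ _ _) IH map_mxM.
exists (\tr (pw _ M k)); rewrite -trace_map_mx -pwM.
have -> : \tr (pw _ A k) = \tr (pw _ T k).
  by rewrite pwP mxtrace_mulC mulmxA mulVmx // mul1mx.
by apply: eq_bigr => i _; rewrite (pwT k).2.
Qed.

(* The vectors of n consecutive power sums of the roots are bounded integer
   vectors, so two of them coincide, say those starting at k and l. Then
   sum_i d_i^k h(d_i) = sum_i d_i^l h(d_i) for every h of degree less than n,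
   and h can be chosen to vanish at all roots but z. *)
Lemma kronecker (g : {poly int}) (z : C) : g \is monic ->
  (forall x, root (map_poly intr g : {poly C}) x -> `|x| <= 1) ->
  root (map_poly intr g) z -> z != 0 ->
  exists2 m : nat, (0 < m)%N & m.-unity_root z.
Proof.
move=> mg disk gz z0; have [n [d [gE intP]]] := power_sums_int mg.
have d_le1 i : `|d i| <= 1.
  apply: disk; rewrite gE /root horner_prod prodf_seq_eq0.
  by apply/hasP; exists i; rewrite ?mem_index_enum //= !hornerE subrr.
have [i0 di0] : exists i, z = d i.
  move: gz; rewrite gE /root horner_prod prodf_seq_eq0 => /hasP [i _].
  by rewrite !hornerE subr_eq0 => /eqP ->; exists i.
have {intP} [t tE] := choice intP.
have t_le k : `|t k| <= n%:Z.
  rewrite -(ler_int C) intr_norm -tE (le_trans (ler_norm_sum _ _ _)) //.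
  rewrite (le_trans (ler_sum _ (G := fun=> 1) _)) // => [i _|].
    by rewrite normrX exprn_ile1.
  by rewrite sumr_const card_ord.
(* Each power sum lies in [-n, n]; adding n encodes it in 2n+1 values. There are [N] possible
   windows, so [N.+1] starting points force a collision. *)
pose v k : {ffun 'I_n -> 'I_(n + n).+1} :=
  [ffun j : 'I_n => inord (absz (t (k + j)%N + n%:Z))].
pose N := #|{ffun 'I_n -> 'I_(n + n).+1}|.
have /injectivePn [k [l ne_kl vkl]] : ~~ injectiveb (fun k : 'I_N.+1 => v k).
  apply/negP => /injectiveP /leq_card; rewrite card_ord -/N.
  by rewrite ltnn.
wlog lt_kl : k l ne_kl vkl / (k < l)%N.
  move=> IH; have := ne_kl; rewrite neq_ltn => /orP [|] ?; first exact: (IH k l).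
  by apply: (IH l k); rewrite // eq_sym.
have tkl (j : 'I_n) : t (k + j)%N = t (l + j)%N.
  move/ffunP/(_ j): vkl; rewrite !ffunE => /(congr1 val) /=.
  have b m : (absz (t m + n%:Z)%R < (n + n).+1)%N.
    by have := t_le m; lia.
  rewrite !inordK //; have := t_le (k + j)%N; have := t_le (l + j)%N; lia.
pose h := \prod_(x <- enum [pred i | d i != z]) ('X - (d x)%:P).
have sz_h : (size h <= n)%N.
  rewrite size_prod_XsubC -cardE -[n in (_ <= n)%N]card_ord.
  rewrite [X in (_ < X)%N](cardD1 i0) inE add1n ltnS.
  apply/subset_leq_card/fintype.subsetP => i; rewrite !inE andbT di0.
  by apply: contraNneq => ->.
have hd i : h.[d i] = if d i == z then h.[z] else 0.
  case: eqP => [->//|/eqP ne]; rewrite horner_prod; apply/eqP.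
  rewrite prodf_seq_eq0; apply/hasP; exists i; rewrite ?mem_enum //=.
  by rewrite !hornerE subrr.
have hz : h.[z] != 0.
  rewrite horner_prod prodf_seq_neq0; apply/allP => i.
  by rewrite mem_enum /= !hornerE subr_eq0 eq_sym.
(* Only the indices with [d i = z] survive, and [z] may be a multiple root: its multiplicity appears
   as a factor, cancelled below because it is positive. *)
have sumh m : z ^+ m * h.[z] *+ #|[pred i | d i == z]| =
    \sum_(j < n) h`_j * (t (m + j)%N)%:~R.
  transitivity (\sum_(i < n) d i ^+ m * h.[d i]).
    rewrite -sumr_const [LHS]big_mkcond; apply: eq_bigr => i _.
    by rewrite hd inE; case: eqP => [->|]; rewrite ?mulr0.
  under eq_bigr => i _ do rewrite (horner_coef_wide _ sz_h) mulr_sumr.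
  rewrite exchange_big; apply: eq_bigr => j _.
  by rewrite -tE mulr_sumr; apply: eq_bigr => i _; rewrite mulrCA exprD.
have: z ^+ k * h.[z] *+ #|[pred i | d i == z]| =
      z ^+ l * h.[z] *+ #|[pred i | d i == z]|.
  by rewrite !sumh; apply: eq_bigr => j _; rewrite tkl.
have c_gt0 : (0 < #|[pred i | d i == z]|)%N.
  by apply/card_gt0P; exists i0; rewrite inE di0.
move=> /(pmulrnI c_gt0) /(mulIf hz) zkl.
exists (l - k)%N; first by rewrite subn_gt0.
apply/unity_rootP; apply: (mulfI (expf_neq0 k z0)).
by rewrite mulr1 -exprD subnKC // ltnW.
Qed.
End Kronecker.

(** * Splitting off cyclotomic polynomials *)

Lemma Cyclotomic_dvd_Xn_sub_1 d n : (0 < n)%N -> (d %| n)%N ->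
  exists h, 'X^n - 1 = 'Phi_d * h.
Proof.
move=> n_gt0 dn; rewrite -(prod_Cyclotomic n_gt0) (big_rem d) /=.
  by eexists.
by rewrite -dvdn_divisors.
Qed.

(** In any closed field, [z] is a root of X^n - 1, the product of the ['Phi_d] with d dividing n. If
    ['Phi_d] vanishes at [z] then z^d = 1, and primitivity makes n divide d. *)
Lemma root_Cyclotomic (C : numClosedFieldType) n (z : C) :
  n.-primitive_root z -> root (map_poly intr 'Phi_n) z.
Proof.
move=> pz; have n_gt0 := prim_order_gt0 pz.
have : root (map_poly intr ('X^n - 1 : {poly int})) z.
  by rewrite rmorphB rmorph1 /= map_polyXn /root !hornerE prim_expr_order // subrr.
rewrite -(prod_Cyclotomic n_gt0) rmorph_prod /root horner_prod prodf_seq_eq0.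
move=> /hasP [d]; rewrite -dvdn_divisors // => dn /= dz.
suff /eqP <- : d == n by [].
rewrite eqn_dvd dn (prim_order_dvd pz).
have d_gt0 := dvdn_gt0 n_gt0 dn.
have [h /(congr1 (fun p => (map_poly intr p).[z]))] :=
  Cyclotomic_dvd_Xn_sub_1 d_gt0 (dvdnn d).
rewrite rmorphB rmorph1 rmorphM /= map_polyXn !hornerE (eqP dz) mul0r.
by move=> /eqP; rewrite subr_eq0.
Qed.

(** Irreducibility is used through minimal polynomials in [algC], whereas [z] lies in [C]. The gcd
    over the rationals moves between the two fields: the common root [z] makes it nonconstant, so it
    has a root [w] in [algC], a primitive n-th root of unity with minimal polynomial ['Phi_n]. *)
Lemma Cyclotomic_dvdp (C : numClosedFieldType) n (z : C) (g : {poly int}) :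
  n.-primitive_root z -> root (map_poly intr g) z -> exists h, g = 'Phi_n * h.
Proof.
move=> pz gz; have n_gt0 := prim_order_gt0 pz.
pose Q (p : {poly int}) : {poly rat} := map_poly intr p.
have QC (F : numFieldType) p : map_poly ratr (Q p) = map_poly intr p :> {poly F}.
  by rewrite -map_poly_comp; apply: eq_map_poly => b; rewrite /= rmorph_int.
have ncop : ~~ coprimep (Q 'Phi_n) (Q g).
  apply/negP; rewrite -(coprimep_map (@ratr C)) !QC => cop.
  have := coprimep_root cop (root_Cyclotomic pz).
  by rewrite (eqP gz) eqxx.
have Phi0 : Q 'Phi_n != 0 by apply/monic_neq0/monic_map/Cyclotomic_monic.
pose k := gcdp (Q 'Phi_n) (Q g).
have /closed_rootP [w kw] : size (map_poly ratr k : {poly algC}) != 1%N.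
  by rewrite size_map_poly.
have [z0 pz0] := C_prim_root_exists n_gt0.
have rPhi : root (map_poly intr 'Phi_n) w.
  by rewrite -QC; apply: root_dvdp kw; rewrite dvdp_map dvdp_gcdl.
have pw : n.-primitive_root w.
  by move: rPhi; rewrite (Cintr_Cyclotomic pz0) root_cyclotomic.
have [p [Dp mp] pP] := minCpolyP w.
have pE : p = Q 'Phi_n.
  apply: (map_inj_poly (fmorph_inj (ratr : rat -> algC)) (rmorph0 _)).
  by rewrite QC -Dp (minCpoly_cyclotomic pw) (Cintr_Cyclotomic pw).
have : p %| Q g.
  by rewrite (dvdp_trans _ (dvdp_gcdr (Q 'Phi_n) (Q g))) // -pP.
(* By Gauss's lemma divisibility over the rationals descends to the integers, ['Phi_n] being monic
   and so its own primitive part. *)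
rewrite pE dvdp_rat_int => /dvdpP_int [h ->].
by exists h; rewrite zprimitive_monic // Cyclotomic_monic.
Qed.

(** Induction on the size: a root 0 splits off ['X], a root of unity of exact order k splits off
    ['Phi_k], and a polynomial without roots is the constant [c], whose sign is still open. *)
Lemma cyclotomic_factorization (C : numClosedFieldType) (g : {poly int}) :
  g != 0 ->
  (forall z : C, root (map_poly intr g) z ->
     z = 0 \/ exists2 n : nat, (0 < n)%N & n.-unity_root z) ->
  exists (c : int) (beta : nat) (s : seq nat),
    {in s, forall n, 0 < n}%N /\ g = c%:P * 'X^beta * \prod_(n <- s) 'Phi_n.
Proof.
elim: {g}(size g) {-2}g (leqnn (size g)) => [|m IH] g.
  by rewrite leqn0 size_poly_eq0 => /eqP ->; rewrite eqxx.
move=> sz g0 gr; have [sz1|sz1] := eqVneq (size g) 1%N.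
  have /size1_polyC gE : (size g <= 1)%N by rewrite sz1.
  by exists g`_0, 0%N, [::]; split=> //; rewrite big_nil !mulr1.
have /closed_rootP [z gz] : size (map_poly intr g : {poly C}) != 1%N.
  by rewrite size_map_inj_poly // => x y /intr_inj.
have rootM (h q : {poly int}) : g = q * h ->
    forall x : C, root (map_poly intr h) x ->
    x = 0 \/ exists2 n : nat, (0 < n)%N & n.-unity_root x.
  by move=> gE x hx; apply: gr; rewrite gE rmorphM rootM hx orbT.
have [z0|[n n_gt0 /unity_rootP zn]] := gr z gz.
  have [h gE] : exists h, g = h * 'X.
    have /factor_theorem [h ->] : root g 0.
      move: gz; rewrite z0 /root !horner_coef0 coef_map /=.
      by rewrite intr_eq0.
    by exists h; rewrite subr0.
  have h0 : h != 0 by apply: contraNneq g0 => h0; rewrite gE h0 mul0r.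
  have szh : (size h <= m)%N by move: sz; rewrite gE size_mulX.
  have [c [b [s [s0 hE]]]] := IH h szh h0 (rootM _ 'X (etrans gE (mulrC _ _))).
  exists c, b.+1, s; split=> //; rewrite gE hE exprSr; ring.
have [k pz _] := prim_order_exists n_gt0 zn.
have [h gE] := Cyclotomic_dvdp pz gz.
have k_gt0 := prim_order_gt0 pz.
have h0 : h != 0 by apply: contraNneq g0 => h0; rewrite gE h0 mulr0.
have szh : (size h <= m)%N.
  move: sz; rewrite gE size_monicM ?Cyclotomic_monic // size_Cyclotomic /=.
  have : (0 < totient k)%N by rewrite totient_gt0.
  lia.
have [c [b [s [s0 hE]]]] := IH h szh h0 (rootM _ _ gE).
exists c, b, (k :: s); split=> [i|]; last by rewrite gE hE big_cons; ring.
by rewrite inE => /orP [/eqP ->|/s0].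
Qed.

(** * Content and leading coefficient *)

Lemma prod_Cyclotomic_monic (beta : nat) (s : seq nat) :
  'X^beta * \prod_(n <- s) 'Phi_n \is monic.
Proof.
by rewrite monicMl ?monicXn //; apply: monic_prod => i _; apply: Cyclotomic_monic.
Qed.

(** The nonnegative content of [f], spelled as in condition (ii) so that the two are convertible. *)
Definition coef_gcd (f : {poly int}) : nat :=
  \big[gcdn/0%N]_(k < size f) `|(f`_k)%R|%N.

Lemma coef_gcd_monic (alpha : nat) (g : {poly int}) : g \is monic ->
  coef_gcd (alpha%:R * g) = alpha.
Proof.
move=> mg; have cf k : (alpha%:R * g)`_k = alpha%:Z * g`_k.
  by rewrite mulr_natl coefMn -mulr_natl natz.
case: (posnP alpha) => [->|a_gt0].
  by rewrite mul0r /coef_gcd size_poly0 big_ord0.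
have szg : size (alpha%:R * g) = size g.
  by rewrite -polyC_natr mul_polyC size_scale // pnatr_eq0 -lt0n.
apply/eqP; rewrite eqn_dvd; apply/andP; split.
  have sg : (0 < size g)%N by rewrite size_poly_gt0 monic_neq0.
  have lt : ((size g).-1 < size (alpha%:R * g)%R)%N by rewrite szg prednK.
  rewrite /coef_gcd (bigD1 (Ordinal lt)) //= cf -lead_coefE (monicP mg) mulr1.
  exact: dvdn_gcdl.
rewrite /coef_gcd; elim/big_ind: _ => //= [x y|i _]; first by rewrite dvdn_gcd => -> ->.
by rewrite cf abszM absz_nat dvdn_mulr.
Qed.

(** Dividing every coefficient by the content gives an integer polynomial, and the equality of
    content and leading coefficient makes it monic. *)
Lemma lead_coef_coef_gcd (f : {poly int}) : f != 0 ->
  lead_coef f = (coef_gcd f)%:Z ->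
  exists2 g : {poly int}, g \is monic & f = (coef_gcd f)%:R * g.
Proof.
move=> f0 lE; set c := coef_gcd f in lE *.
have c0 : c%:Z != 0 by rewrite -lE lead_coef_eq0.
have cdvd k : (c%:Z %| f`_k)%Z.
  have [lt_k|ge_k] := ltnP k (size f); last by rewrite nth_default // dvdz0.
  rewrite dvdzE /= /c /coef_gcd (bigD1 (Ordinal lt_k)) //=; exact: dvdn_gcdl.
pose g := \poly_(i < size f) (f`_i %/ c%:Z)%Z.
have fE : f = c%:R * g.
  apply/polyP => k; rewrite mulr_natl coefMn coef_poly -mulr_natl natz.
  case: ltnP => [_|ge_k]; first by rewrite mulrC divzK.
  by rewrite mulr0 nth_default.
exists g; last exact: fE.
rewrite monicE; apply/eqP; apply: (mulfI c0).
rewrite mulr1 -[in RHS]lE [in RHS]fE.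
by rewrite lead_coefM -polyC_natr lead_coefC natz.
Qed.

(** * Quotients of products of 1 - X^a *)

Local Notation "x %:F" := (@FracField.tofrac _ x) : ring_scope.
Local Notation q1 s := (\prod_(x <- s) (1 - 'X^x : {poly int})).

Lemma qintE n : qint n * (1 - 'X) = 1 - 'X^n.
Proof.
by rewrite mulrC -[in RHS](expr1n _ n) subrXX /qint; congr (_ * _);
   apply: eq_bigr => i _; rewrite expr1n mul1r.
Qed.

Lemma sub1Xn_neq0 n : (0 < n)%N -> 1 - 'X^n != 0 :> {poly int}.
Proof.
by move=> n0; rewrite -opprB oppr_eq0 monic_neq0 // monicXnsubC.
Qed.

Lemma qint_neq0 n : (0 < n)%N -> qint n != 0.
Proof. by move=> /sub1Xn_neq0; apply: contraNneq => q0; rewrite -qintE q0 mul0r. Qed.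

Lemma q1_neq0 s : {in s, forall x, 0 < x}%N -> q1 s != 0.
Proof.
move=> s0; rewrite prodf_seq_neq0; apply/allP => x /s0 x0 /=.
exact: sub1Xn_neq0.
Qed.

(** Condition (iv) with denominators cleared. Sequences replace tuples so that entries can be
    appended and removed; equality of lengths is carried separately. *)
Definition q_factorization (f : {poly int}) (alpha beta : nat) (a b : seq nat) :=
  [/\ (0 < alpha)%N, {in a, forall x, 0 < x}%N, {in b, forall x, 0 < x}%N
    & f * q1 b = alpha%:R * 'X^beta * q1 a].

Lemma qint_factorizationP f alpha beta m (a b : m.-tuple nat) :
  qint_factorization f alpha beta a b <-> q_factorization f alpha beta a b.
Proof.
have frac (a0 : {in a, forall x, 0 < x}%N) (b0 : {in b, forall x, 0 < x}%N) :
    (f%:F = (alpha%:R * 'X^beta)%:F *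
      \prod_(j < m) ((1 - 'X^(tnth a j))%:F / (1 - 'X^(tnth b j))%:F)) <->
    f * q1 b = alpha%:R * 'X^beta * q1 a.
  rewrite prodf_div -!rmorph_prod /= -!(big_tuple _ _ _ xpredT (fun x => 1 - 'X^x)).
  have qb0 := q1_neq0 b0.
  have {}qb0 : (q1 b)%:F != 0 by rewrite tofrac_eq0.
  split=> [/(congr1 ( *%R^~ (q1 b)%:F))|].
    rewrite mulrA divfK // -!rmorphM /=.
    by move=> /eqP; rewrite tofrac_eq => /eqP.
  by move=> /(congr1 (@FracField.tofrac _)); rewrite !rmorphM /= mulrA => <-; rewrite mulfK.
split=> [[al0 a0 b0 _ /(frac a0 b0)]|[al0 a0 b0 /(frac a0 b0) fE]]; first by split.
split=> //; rewrite fE; congr (_ * _); apply: eq_bigr => j _.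
have u0 : (1 - 'X)%:F != 0 :> {fraction {poly int}}.
  by rewrite tofrac_eq0 (@sub1Xn_neq0 1).
by rewrite -!qintE !rmorphM /= -mulf_div divff // mulr1.
Qed.

(** A primitive M-th root of unity annihilates the left product, hence some 1 - X^x with x in [t].
    Then M divides x, and x <= M leaves only x = M. *)
Lemma q1_mem_max (s t : seq nat) (M : nat) : (0 < M)%N ->
  {in t, forall x, 0 < x <= M}%N -> q1 s = q1 t -> M \in s -> M \in t.
Proof.
move=> M0 tM st Ms; have [z pz] := C_prim_root_exists M0.
have: (map_poly intr (q1 s)).[z] = 0.
  rewrite rmorph_prod horner_prod; apply/eqP; rewrite prodf_seq_eq0; apply/hasP.
  exists M => //=; rewrite rmorphB rmorph1 /= map_polyXn !hornerE.
  by rewrite prim_expr_order // subrr.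
rewrite st rmorph_prod horner_prod => /eqP; rewrite prodf_seq_eq0 => /hasP [x xt].
rewrite /= rmorphB rmorph1 /= map_polyXn !hornerE subr_eq0 eq_sym -(prim_order_dvd pz).
move=> Mx; have /andP [x0 xM] := tM x xt.
by have -> : M = x by apply/eqP; rewrite eqn_leq xM dvdn_leq.
Qed.

Lemma seq_max (u : seq nat) : u != [::] ->
  exists2 M, M \in u & {in u, forall x, x <= M}%N.
Proof.
case: u => // x u _; exists (\max_(y <- x :: u) y)%N; last first.
  by move=> y yu; apply: (@bigop.leq_bigmax_seq _ (x :: u) xpredT id).
elim: u x => [|y u IH] x; first by rewrite big_seq1 mem_head.
rewrite big_cons; case: (leqP x (\max_(z <- y :: u) z)) => [_|_].
  by rewrite in_cons IH orbT.
by rewrite mem_head.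
Qed.

(** The largest entry of [s ++ t] occurs in both sequences by [q1_mem_max]; its factor cancels and
    induction applies. *)
Lemma q1_inj (s t : seq nat) :
  {in s, forall x, 0 < x}%N -> {in t, forall x, 0 < x}%N ->
  q1 s = q1 t -> perm_eq s t.
Proof.
elim: {s}(size s) {-2}s (erefl (size s)) t => [|n IH] s szs t s0 t0 st.
  case: s szs s0 st => // _ s0 st; case: t t0 st => // y t t0 st.
  have [M Mt leM] := @seq_max (y :: t) isT.
  by have := @q1_mem_max (y :: t) [::] M (t0 M Mt) (fun _ => ltac:(by []))
    (esym st) Mt.
have [|M Mst leM] := @seq_max (s ++ t); first by case: (s) szs.
have [Ms Mt] : M \in s /\ M \in t.
  have leMs x : x \in s -> (0 < x <= M)%N.
    by move=> xs; rewrite s0 // leM // mem_cat xs.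
  have leMt x : x \in t -> (0 < x <= M)%N.
    by move=> xt; rewrite t0 // leM // mem_cat xt orbT.
  have M0 : (0 < M)%N by move: Mst; rewrite mem_cat => /orP [/s0|/t0].
  move: Mst; rewrite mem_cat => /orP [Ms|Mt]; split=> //.
    exact: (q1_mem_max M0 leMt st).
  exact: (q1_mem_max M0 leMs (esym st)).
rewrite (permPl (perm_to_rem Ms)) (permPr (perm_to_rem Mt)) perm_cons.
apply: IH; first by rewrite size_rem // szs.
- by move=> x /mem_rem /s0.
- by move=> x /mem_rem /t0.
apply: (mulfI (sub1Xn_neq0 (s0 M Ms))).
by move: st; rewrite (big_rem M Ms) (big_rem M Mt).
Qed.

Lemma q1_horner0 s : {in s, forall x, 0 < x}%N -> (q1 s).[0] = 1.
Proof.
move=> s0; rewrite horner_prod big1_seq // => x /andP [_ /s0 x0].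
by rewrite !hornerE expr0n gtn_eqF // subr0.
Qed.

(** The products have constant term 1, so the order of vanishing at 0 determines the power of ['X],
    and the value at 0 after cancelling that power determines the constant. *)
Lemma q1_shift_inj (al be al' be' : nat) s t :
  (0 < al)%N -> (0 < al')%N ->
  {in s, forall x, 0 < x}%N -> {in t, forall x, 0 < x}%N ->
  al%:R * 'X^be * q1 s = al'%:R * 'X^be' * q1 t ->
  [/\ al = al', be = be' & perm_eq s t].
Proof.
move=> al0 al0' s0 t0.
wlog le_be : al al' be be' s t al0 al0' s0 t0 / (be <= be')%N.
  move=> IH E; have [/IH|/ltnW /IH] := leqP be be'; first exact.
  by case/(_ _ _ t s al0' al0 t0 s0 (esym E)) => -> -> pst; split; rewrite // perm_sym.
move=> E; have {}E : al%:R * q1 s = al'%:R * 'X^(be' - be) * q1 t.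
  apply: (mulfI (monic_neq0 (monicXn int be))).
  by rewrite mulrCA mulrA E -{1}(subnKC le_be) exprD; ring.
have /(congr1 (fun p => p.[0])) := E.
rewrite !hornerM !q1_horner0 // hornerXn -!polyC_natr !hornerC !mulr1 expr0n.
case: eqP => [be0|_] /eqP; last by rewrite mulr0 pnatr_eq0 gtn_eqF.
rewrite mulr1 eqr_nat => /eqP alE; split=> //.
  by apply/eqP; rewrite eqn_leq le_be -subn_eq0 be0.
apply: q1_inj => //; move: E; rewrite be0 mulr1 alE => /mulfI; apply.
by rewrite -polyC_natr polyC_eq0 pnatr_eq0 -lt0n.
Qed.

(** Meant for the multiplicities of a single integer in [a], [b], [a'], [b'], in this order. *)
Lemma cancel_disjoint (c1 c2 c3 c4 : nat) :
  ((0 < c3)%N -> ~~ (0 < c4)%N) -> ((0 < c1)%N -> ~~ (0 < c2)%N) ->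
  (c1 + c4 = c3 + c2)%N -> c1 = c3 /\ c2 = c4.
Proof.
case: c1 c2 c3 c4 => [|?] [|?] [|?] [|?] // H1 H2 H3.
all: by [have := H1 isT | have := H2 isT | lia].
Qed.

(** Cross-multiplying the two identities shows that [a ++ b'] and [a' ++ b] are the same multiset;
    disjointness then separates the multiplicities. *)
Lemma q_factorization_uniq f alpha beta alpha' beta' a b a' b' :
  q_factorization f alpha beta a b -> disjoint_multisets a b ->
  q_factorization f alpha' beta' a' b' -> disjoint_multisets a' b' ->
  [/\ alpha = alpha', beta = beta', perm_eq a a' & perm_eq b b'].
Proof.
move=> [al0 a0 b0 E] dab [al0' a0' b0' E'] dab'.
have catpos (s t : seq nat) : {in s, forall x, 0 < x}%N ->
    {in t, forall x, 0 < x}%N -> {in s ++ t, forall x, 0 < x}%N.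
  by move=> s0 t0 x; rewrite mem_cat => /orP [/s0|/t0].
have [] := @q1_shift_inj alpha beta alpha' beta' (a ++ b') (a' ++ b).
- by [].
- by [].
- exact: catpos.
- exact: catpos.
- rewrite !big_cat /= !mulrA -E -E' mulrAC; ring.
move=> -> -> /permP p.
have cnt x : count_mem x a = count_mem x a' /\ count_mem x b = count_mem x b'.
  have := p (pred1 x); rewrite !count_cat.
  have := dab x; have := dab' x; rewrite -!has_pred1 !has_count.
  exact: cancel_disjoint.
by split=> //; apply/allP => x _ /=; apply/eqP; case: (cnt x).
Qed.

(** An entry common to both sequences contributes the same nonzero factor to both sides, so one copy
    can be removed from each. *)
Lemma q_factorization_disjoint f alpha beta (a b : seq nat) :
  q_factorization f alpha beta a b -> size a = size b ->
  exists a' b', [/\ q_factorization f alpha beta a' b', size a' = size b'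
    & disjoint_multisets a' b'].
Proof.
elim: {a}(size a) {-2}a (leqnn (size a)) b => [|n IH] a sza b [al0 a0 b0 E] szab.
  exists a, b; split=> // x; case: (a) sza => //.
have [/allP dab|/allPn [x xa]] := boolP (all [pred x | x \notin b] a).
  by exists a, b.
rewrite /= negbK => xb.
apply: (IH (rem x a) _ (rem x b)).
- by rewrite size_rem // -subn1 leq_subLR add1n.
- split=> // [y /mem_rem /a0|y /mem_rem /b0|] //.
  apply: (mulfI (sub1Xn_neq0 (a0 x xa))); rewrite mulrCA [in RHS]mulrCA.
  by move: E; rewrite (big_rem x xa) (big_rem x xb) /= => E.
by rewrite !size_rem // szab.
Qed.

(** * Cyclotomic polynomials as quotients of equally long products *)

Definition q_quotient (f : {poly int}) := exists a b : seq nat,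
  [/\ {in a, forall x, 0 < x}%N, {in b, forall x, 0 < x}%N, size a = size b
    & f * q1 b = q1 a].

Lemma q_quotient_prod (s : seq nat) :
  {in s, forall n, q_quotient 'Phi_n} -> q_quotient (\prod_(n <- s) 'Phi_n).
Proof.
elim: s => [_|n s IH sq].
  by exists [::], [::]; split=> //; rewrite !big_nil mulr1.
have [a [b [a0 b0 sz E]]] := IH (fun x xs => sq x (mem_behead (s := n :: s) xs)).
have [a' [b' [a0' b0' sz' E']]] := sq n (mem_head n s).
exists (a' ++ a), (b' ++ b); split.
- by move=> x; rewrite mem_cat => /orP [/a0'|/a0].
- by move=> x; rewrite mem_cat => /orP [/b0'|/b0].
- by rewrite !size_cat sz sz'.
- by rewrite big_cons !big_cat /= -E -E'; ring.
Qed.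

Lemma Cyclotomic1 : 'Phi_1 = 'X - 1.
Proof. by have := prod_Cyclotomic (ltn0Sn 0); rewrite /= big_seq1. Qed.

(** Strong induction. The index 1 is excluded because a quotient of equally long products does not
    vanish at 1, while ['Phi_1] does. The two sequences trade roles since the smaller cyclotomic
    factors stand on the side of ['Phi_n]. *)
Lemma q_quotient_Cyclotomic n : (1 < n)%N -> q_quotient 'Phi_n.
Proof.
elim/ltn_ind: n => n IH n_gt1.
have n_gt0 : (0 < n)%N by exact: ltnW.
(* The divisors of n strictly between 1 and n: those to which the induction hypothesis applies. *)
pose D := rem 1%N (rem n (divisors n)).
have uD := divisors_uniq n.
have DE : {in D, forall d, 1 < d < n}%N.
  move=> d; rewrite mem_rem_uniq ?rem_uniq // inE mem_rem_uniq // inE -dvdn_divisors //.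
  move=> /and3P [d1 dn ddn]; have := dvdn_leq n_gt0 ddn; have := dvdn_gt0 n_gt0 ddn.
  lia.
have [|a [b [a0 b0 sz E]]] := @q_quotient_prod D.
  by move=> d /DE /andP [d1 dn]; apply: IH.
have PE : 'Phi_n * ('X - 1) * (\prod_(d <- D) 'Phi_d) = 'X^n - 1.
  rewrite -(prod_Cyclotomic n_gt0) [in RHS](big_rem n) ?divisors_id //=.
  have one_in : 1%N \in rem n (divisors n).
    by rewrite mem_rem_uniq // inE neq_ltn n_gt1 -dvdn_divisors // dvd1n.
  rewrite [in RHS](big_rem 1%N) /=; last exact: one_in.
  by rewrite Cyclotomic1 mulrA.
exists (n :: b), (1%N :: a); split.
- by move=> x; rewrite inE => /orP [/eqP ->|/b0].
- by move=> x; rewrite inE => /orP [/eqP ->|/a0].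
- by rewrite /= sz.
rewrite !big_cons -E expr1 -[1 - 'X]opprB -[1 - 'X^n]opprB -PE; ring.
Qed.

Lemma coef_sum_gt0 (f : {poly int}) : f != 0 -> (forall k, 0 <= f`_k) -> 0 < f.[1].
Proof.
move=> f0 fge; have lt : ((size f).-1 < size f)%N by rewrite prednK // size_poly_gt0.
rewrite horner_coef (bigD1 (Ordinal lt)) //=.
rewrite -lead_coefE expr1n mulr1 ltr_wpDr //.
  by apply: sumr_ge0 => i _; rewrite expr1n mulr1.
by rewrite lt_def lead_coef_eq0 f0 lead_coefE fge.
Qed.

Lemma q_factorization_Cyclotomic f alpha beta s : f.[1] != 0 ->
  (0 < alpha)%N -> {in s, forall n, 0 < n}%N ->
  f = alpha%:R * 'X^beta * \prod_(n <- s) 'Phi_n ->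
  exists a b, size a = size b /\ q_factorization f alpha beta a b.
Proof.
move=> f1 al0 s0 fE; have [|a [b [a0 b0 sz E]]] := @q_quotient_prod s.
  move=> n ns; apply: q_quotient_Cyclotomic; move: (s0 n ns).
  case: n ns => [|[|n]] // ns _; case/negP: f1.
  rewrite fE hornerM horner_prod mulf_eq0; apply/orP; right.
  rewrite prodf_seq_eq0; apply/hasP; exists 1%N => //=.
  by rewrite Cyclotomic1 !hornerE subrr.
by exists a, b; split=> //; split=> //; rewrite [in LHS]fE -[LHS]mulrA E.
Qed.

(** * Laws of sums of independent variables *)

Section SumLaw.
Context (d : measure_display) (T : measurableType d) (R : realType)
        (P : probability T R) (I : finType) (Y : I -> {RV P >-> nat}).

Lemma measurable_preimage_nat (X : {RV P >-> nat}) (B : set nat) :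
  measurable (X @^-1` B).
Proof. by rewrite -[_ @^-1` _]setTI; apply: measurable_funPT. Qed.

(** Forcing the value 0 outside [J] keeps one representative per assignment on [J], which makes the
    events disjoint and matches the index set of generalized distributivity. *)
Definition sum_configs (J : {set I}) (k : nat) (N : nat) :=
  [pred phi : {ffun I -> 'I_N.+1} |
   (phi \in pffun_on ord0 (mem J) predT) && (\sum_(i in J) phi i == k)%N].

Definition config_event (J : {set I}) (N : nat) (phi : {ffun I -> 'I_N.+1}) :=
  \bigcap_(i in [set i | i \in J]) Y i @^-1` [set (phi i : nat)].

Lemma measurable_config_event (J : {set I}) (N : nat) (phi : {ffun I -> 'I_N.+1}) :
  measurable (config_event J phi).
Proof.
apply: fin_bigcap_measurable => [|i _]; first exact: finite_finset.
exact: measurable_preimage_nat.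
Qed.

(* The summands are natural numbers, so none of them exceeds the sum [k]: finitely
   many configurations suffice even though the [Y i] may be unbounded. *)
Lemma sum_eq_bigcup (J : {set I}) (k N : nat) : (k < N.+1)%N ->
  [set w | (\sum_(i in J) Y i w)%N = k] =
  \bigcup_(phi in [set` sum_configs J k N]) config_event J phi.
Proof.
move=> kN; apply/seteqP; split=> [w /= wk|w [phi /= /andP [_ /eqP <-]] Ew]; last first.
  by apply: eq_bigr => i iJ; apply: (Ew i).
have Yle i : i \in J -> (Y i w < N.+1)%N.
  by move=> iJ; rewrite (leq_ltn_trans _ kN) // -wk (bigD1 i) //= leq_addr.
pose phi := [ffun i => if i \in J then inord (Y i w) else ord0 : 'I_N.+1].
have phiE i : i \in J -> phi i = Y i w :> nat.
  by move=> iJ; rewrite ffunE iJ inordK // Yle.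
exists phi; last by move=> i /= iJ; rewrite phiE.
apply/andP; split; last by rewrite -wk; apply/eqP/eq_bigr => i /phiE.
apply/pffun_onP; split=> //; apply/fintype.subsetP => i; rewrite inE ffunE.
by case: ifP => //; rewrite eqxx.
Qed.

Lemma measurable_sum_eq (J : {set I}) (k : nat) :
  measurable [set w | (\sum_(i in J) Y i w)%N = k].
Proof.
rewrite (sum_eq_bigcup J (ltnSn k)); apply: fin_bigcup_measurable.
  exact: finite_finset.
by move=> phi _; apply: measurable_config_event.
Qed.

(** Independence turns the probability of a configuration into a product of coefficients of the
    [G i]; summing over configurations of total k is what expanding the product of the [G i] gives
    in degree k. *)
Lemma sum_independent_law (G : I -> {poly R}) (J : {set I}) (k : nat) :
  mutually_independent Y ->
  (forall i j, P (Y i @^-1` [set j]) = ((G i)`_j)%:E) ->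
  P [set w | (\sum_(i in J) Y i w)%N = k] = ((\prod_(i in J) G i)`_k)%:E.
Proof.
(* This bound exceeds neither less than k nor any degree: it covers all summands of a sum equal to k
   and all nonzero coefficients of every [G i]. *)
move=> indep law; pose N := (k + \sum_(i : I) size (G i))%N.
have kN : (k < N.+1)%N by rewrite ltnS leq_addr.
have GE i : G i = \sum_(j < N.+1) (G i)`_j *: 'X^j.
  rewrite -poly_def; apply/polyP => j; rewrite coef_poly; case: ltnP => // Nj.
  rewrite nth_default // (leq_trans _ Nj) // ltnW // ltnS.
  by rewrite /N (bigD1 i) //= addnCA leq_addr.
have PE (phi : {ffun I -> 'I_N.+1}) :
    P (config_event J phi) = (\prod_(i in J) (G i)`_(phi i))%:E.
  rewrite /config_event (indep J (fun i => [set (phi i : nat)])) // -prodEFin.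
  by apply: eq_bigr => i _; rewrite law.
rewrite (sum_eq_bigcup J kN) measure_fin_bigcup //; first last.
- by move=> phi _; apply: measurable_config_event.
- move=> phi psi /= /andP [pA _] /andP [qA _] [w [pw qw]].
  apply/ffunP => i; apply: val_inj => /=.
  have [iJ|iJ] := boolP (i \in J); first by rewrite -(pw i iJ) -(qw i iJ).
  have off (phi' : {ffun I -> 'I_N.+1}) :
      phi' \in pffun_on ord0 (mem J) predT -> phi' i = ord0.
    move=> /pffun_onP [/fintype.subsetP /(_ i) sub _].
    by apply/eqP; apply: contraNT iJ => ne; apply: sub; rewrite inE.
  by rewrite (off phi) // (off psi).
rewrite -(@bigfs _ _ _ _ (index_enum {ffun I -> 'I_N.+1})) ?index_enum_uniq //;
  last by move=> phi _; rewrite mem_index_enum.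
rewrite (eq_bigr (fun phi : {ffun I -> 'I_N.+1} =>
  (\prod_(i in J) (G i)`_(phi i))%:E)); last by move=> phi _; exact: PE.
rewrite sumEFin; congr (_%:E).
under [in RHS]eq_bigr => i _ do rewrite GE.
rewrite (big_distr_big ord0) coef_sum.
rewrite big_mkcondr /=; apply: eq_bigr => phi _.
rewrite scaler_prod -expr_sum coefZ coefXn.
by rewrite eq_sym; case: eqP => _; rewrite ?mulr1 ?mulr0.
Qed.
End SumLaw.

(** * A finite product space coded in the natural numbers *)

Section ProductSpace.
Context (R : realType) (I : finType) (N : nat) (p : I -> nat -> R).
Hypothesis p_ge0 : forall i j, 0 <= p i j.
Hypothesis p_sum1 : forall i, \sum_(j < N.+1) p i j = 1.

Local Notation config := {ffun I -> 'I_N.+1}.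

Definition config_weight (phi : config) : R := \prod_(i : I) p i (phi i).

Lemma config_weight_ge0 phi : 0 <= config_weight phi.
Proof. exact: prodr_ge0. Qed.

(** Configurations are coded by an initial segment of [nat], on which every set is measurable.
    Beyond the enumeration the default configuration is returned, but [product_prob] puts no mass
    there. *)
Definition decode (k : nat) : config := nth [ffun=> ord0] (enum {: config}) k.

Definition product_prob : set nat -> \bar R :=
  msum (fun k => mscale (NngNum (config_weight_ge0 (decode k))) (\d_k))
    #|{: config}|.

HB.instance Definition _ := Measure.on product_prob.

Lemma product_probE (A : set nat) (E : pred config) :
  (forall k, A k <-> E (decode k)) ->
  product_prob A = (\sum_(phi | E phi) config_weight phi)%:E.
Proof.
move=> AE; rewrite /product_prob /msum.
transitivity (\sum_(k < #|{: config}|)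
    (config_weight (decode k) * (E (decode k))%:R)%:E)%E.
  apply: eq_bigr => k _.
  transitivity ((config_weight (decode k))%:E * (\d_(k : nat) : set nat -> \bar R) A)%E => //.
  rewrite diracE EFinM; congr (_ * _%:R%:E)%E.
  by congr nat_of_bool; apply/idP/idP => [/set_mem /AE|/AE /mem_set].
rewrite sumEFin; congr (_%:E); rewrite [RHS]big_mkcond /=.
rewrite (reindex (@enum_val _ {: config})) /=; last first.
  by exists enum_rank => k _; rewrite (enum_valK, enum_rankK).
apply: eq_bigr => k _; rewrite /decode -(enum_val_nth [ffun=> ord0]).
by case: (E _); rewrite ?mulr1 ?mulr0.
Qed.

Lemma product_prob_setT : product_prob setT = 1%E.
Proof.
rewrite (@product_probE setT xpredT) // /config_weight.
rewrite -(bigA_distr_bigA (fun i (j : 'I_N.+1) => p i j)).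
by rewrite big1.
Qed.

HB.instance Definition _ :=
  @Measure_isProbability.Build _ _ R product_prob product_prob_setT.

Definition coordinate (i : I) (k : nat) : nat := decode k i.

Lemma measurable_coordinate i : measurable_fun setT (coordinate i).
Proof. by move=> _ B _. Qed.

HB.instance Definition _ i :=
  isMeasurableFun.Build _ _ nat nat (coordinate i) (measurable_coordinate i).

Definition coordinate_rv (i : I) : {RV product_prob >-> nat} := coordinate i.

(** Distributivity turns the sum of weights over a box into a product of sums; a coordinate outside
    [J] is unconstrained and contributes the total mass 1. *)
Lemma product_prob_bigcap (J : {set I}) (B : I -> set nat) :
  product_prob (\bigcap_(i in [set i | i \in J]) coordinate_rv i @^-1` B i) =
  (\prod_(i in J) \sum_(j < N.+1 | (j : nat) \in B i) p i j)%:E.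
Proof.
rewrite (@product_probE _ (fun phi => [forall (i | i \in J), (phi i : nat) \in B i])).
  congr (_%:E).
  transitivity (\prod_i \sum_(j < N.+1 | (i \in J) ==> ((j : nat) \in B i)) p i j).
    rewrite bigA_distr_big_dep; apply: eq_bigl => phi.
    by apply/forallP/familyP => h i; have := h i.
  rewrite [RHS]big_mkcond; apply: eq_bigr => i _; case: ifP => iJ /=.
    by [].
  by rewrite p_sum1.
move=> k; split=> [h|/forallP h i /= iJ]; last by have := h i; rewrite iJ => /set_mem.
by apply/forallP => i; apply/implyP => iJ; apply/mem_set/h.
Qed.

Lemma coordinate_independent : mutually_independent coordinate_rv.
Proof.
move=> J B _; apply: (etrans (product_prob_bigcap J B)).
rewrite -prodEFin; apply: eq_bigr => i _.
have := product_prob_bigcap [set i]%SET B.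
have -> : [set i0 | i0 \in [set i]%SET] = [set i].
  by apply/seteqP; split=> x /=; rewrite inE => /eqP.
by rewrite bigcap_set1 big_set1 => <-.
Qed.

Lemma coordinate_law i j : (forall j, (N < j)%N -> p i j = 0) ->
  product_prob (coordinate_rv i @^-1` [set j]) = (p i j)%:E.
Proof.
move=> p0; have := product_prob_bigcap [set i]%SET (fun=> [set j]).
have -> : [set i0 | i0 \in [set i]%SET] = [set i].
  by apply/seteqP; split=> x /=; rewrite inE => /eqP.
rewrite bigcap_set1 big_set1 => ->; congr (_%:E).
have [jN|Nj] := leqP j N.
  rewrite (big_pred1 (Ordinal (jN : (j < N.+1)%N))) // => k.
  by apply/idP/eqP => [/set_mem /= kj|->]; [apply: val_inj|apply/mem_set].
rewrite big1 ?p0 // => k /set_mem /= kj.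
by move: (ltn_ord k); rewrite kj ltnS leqNgt Nj.
Qed.

End ProductSpace.

(** * Probability generating functions *)

(** By countable additivity a law on [nat] is determined by its point masses. *)
Lemma pushforward_nat_eq d (T : measurableType d) (R : realType)
    (P : probability T R) (S S' : T -> nat) :
  (forall k, measurable [set w | S w = k]) ->
  (forall k, measurable [set w | S' w = k]) ->
  (forall k, P [set w | S w = k] = P [set w | S' w = k]) ->
  pushforward P S = pushforward P S'.
Proof.
have pE (V : T -> nat) (A : set nat) : (forall k, measurable [set w | V w = k]) ->
    pushforward P V A = (\sum_(i <oo | i \in A) P [set w | V w = i])%E.
  move=> mV; rewrite /pushforward -measure_bigcup //; last first.
    by move=> i j _ _ [w [/= <- <-]].
  congr (P _); apply/seteqP; split=> [w Aw|w [i Ai /= wi]].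
    by exists (V w).
  by rewrite /preimage /= wi.
move=> mS mS' E; apply/funext => A; rewrite !pE //.
by apply: eq_eseriesr => i _; rewrite E.
Qed.

Lemma X_shift_eq (R : idomainType) (m n : nat) (p q : {poly R}) :
  p.[0] != 0 -> q.[0] != 0 -> 'X^m * p = 'X^n * q -> m = n.
Proof.
wlog le_mn : m n p q / (m <= n)%N.
  move=> IH p0 q0 E; have [le|lt] := leqP m n; first exact: (IH m n p q).
  exact: (esym (IH n m q p (ltnW lt) q0 p0 (esym E))).
move=> p0 q0; rewrite -(subnKC le_mn) exprD -mulrA.
move=> /(mulfI (monic_neq0 (monicXn R m))) pE.
move: p0; rewrite pE hornerM hornerXn expr0n.
by case: (n - m =P 0)%N => [->|_]; rewrite ?addn0 // mul0r eqxx.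
Qed.

(** Both sides have the same order of vanishing at 0, to which [g] and [h] contribute nothing. *)
Lemma largest_X_powerP (f g h : {poly int}) (beta : nat) : f != 0 ->
  g.[0] != 0 -> h.[0] != 0 -> f * g = 'X^beta * h -> largest_X_power f beta.
Proof.
move=> f0 g0 h0 E; have [n [q /implyP /(_ f0) q0 fE]] := multiplicity_XsubC f 0.
rewrite subr0 mulrC in fE.
have nb : n = beta.
  apply: X_shift_eq (_ : 'X^n * (q * g) = 'X^beta * h) => //.
    by rewrite hornerM mulf_neq0.
  by rewrite mulrA -fE.
rewrite -{}nb fE; split=> [|k /dvdpP_int [r]]; first by rewrite dvdp_mulr.
rewrite zprimitive_monic ?monicXn // leqNgt => rE; apply/negP => lt_nk.
move: rE; rewrite -(subnKC (ltnW lt_nk)) exprD -mulrA.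
move=> /(mulfI (monic_neq0 (monicXn _ n))) qE; move: q0.
by rewrite /root qE hornerM hornerXn expr0n subn_eq0 leqNgt lt_nk mul0r eqxx.
Qed.

Section PGF.
Variables (R : realType).
Implicit Types (f : {poly int}).

Definition pgf f : {poly R} := (f.[1])%:~R^-1 *: map_poly intr f.

Lemma coef_pgf f k : (pgf f)`_k = (f`_k)%:~R / (f.[1])%:~R.
Proof. by rewrite coefZ coef_map /= mulrC. Qed.

Lemma coef_qint n k : (qint n)`_k = (k < n)%N%:R.
Proof.
rewrite /qint coef_sum; case: ltnP => [lt|le].
  rewrite (bigD1 (Ordinal lt)) //= coefXn eqxx big1 ?addr0 // => i ne.
  by rewrite coefXn; move: ne; rewrite -val_eqE /= eq_sym => /negbTE ->.
rewrite big1 // => i _; rewrite coefXn; case: eqP => // ki.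
by move: (ltn_ord i); rewrite -ki ltnNge le.
Qed.

Lemma qint1 n : (qint n).[1] = n%:R.
Proof.
rewrite /qint horner_sum (eq_bigr (fun=> 1)) ?sumr_const ?card_ord // => i _.
by rewrite hornerXn expr1n.
Qed.

Lemma coef_pgf_qint n k : (pgf (qint n))`_k = if (k < n)%N then n%:R^-1 else 0.
Proof.
rewrite coef_pgf coef_qint qint1 !rmorph_nat.
by case: ifP => _; rewrite ?mul0r ?mul1r.
Qed.

Lemma pgf1 f : f.[1] != 0 -> (pgf f).[1] = 1.
Proof.
move=> f1; rewrite hornerZ; have := horner_map (intr : int -> R) f 1.
by rewrite rmorph1 => ->; rewrite mulVf // intr_eq0.
Qed.

Lemma pgfM f g : pgf (f * g) = pgf f * pgf g.
Proof.
by rewrite /pgf hornerM intrM invfM rmorphM /= -scalerAl -scalerAr scalerA.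
Qed.

Lemma pgfXn n : pgf 'X^n = 'X^n.
Proof. by rewrite /pgf hornerXn expr1n rmorph1 invr1 scale1r map_polyXn. Qed.

Lemma pgf_prod (I : finType) (F : I -> {poly int}) :
  pgf (\prod_i F i) = \prod_i pgf (F i).
Proof.
apply: (big_morph pgf pgfM).
by rewrite -(expr0 'X) pgfXn.
Qed.

Lemma pgfZ (c : int) f : c != 0 -> pgf (c%:P * f) = pgf f.
Proof.
move=> c0; rewrite pgfM {1}/pgf hornerC map_polyC /= -mul_polyC -polyCM mulVf ?mul1r //.
by rewrite intr_eq0.
Qed.

(** The link between (iv) and (v): an identity of generating functions, from which normalization at
    1 has removed [alpha]. *)
Definition balanced f beta m (a b : m.-tuple nat) :=
  pgf f * \prod_(j < m) pgf (qint (tnth b j)) =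
  'X^beta * \prod_(j < m) pgf (qint (tnth a j)).

(** Both tuples have length m, so (1 - X)^m can be cancelled. *)
Lemma q_factorization_qint f alpha beta m (a b : m.-tuple nat) :
  q_factorization f alpha beta a b ->
  f * \prod_(j < m) qint (tnth b j) =
  alpha%:R * 'X^beta * \prod_(j < m) qint (tnth a j).
Proof.
move=> [_ _ _ E].
have prodE (c : m.-tuple nat) : \prod_(x <- c) (1 - 'X^x) =
    \prod_(j < m) qint (tnth c j) * (1 - 'X) ^+ m.
  rewrite big_tuple -[m in _ ^+ m]card_ord -prodr_const -big_split /=.
  by apply: eq_bigr => j _; rewrite qintE.
apply: (mulIf (expf_neq0 m (sub1Xn_neq0 (ltn0Sn 0)))).
by rewrite expr1 -!mulrA -!prodE E mulrA.
Qed.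

Lemma q_factorization_balanced f alpha beta m (a b : m.-tuple nat) :
  q_factorization f alpha beta a b -> balanced f beta a b.
Proof.
move=> h; have [al0 _ _ _] := h; have E := q_factorization_qint h.
rewrite /balanced -!pgf_prod -pgfM E -mulrA -polyC_natr.
by rewrite pgfZ ?pgfM ?pgfXn // pnatr_eq0 -lt0n.
Qed.

Lemma qint_horner0 n : (0 < n)%N -> (qint n).[0] = 1.
Proof. by move=> n0; rewrite horner_coef0 coef_qint n0. Qed.

Lemma q_factorization_largest f alpha beta m (a b : m.-tuple nat) : f != 0 ->
  q_factorization f alpha beta a b -> largest_X_power f beta.
Proof.
move=> f0 h; have [al0 a0 b0 _] := h; have := q_factorization_qint h.
rewrite (mulrC alpha%:R) -mulrA; apply: largest_X_powerP => //.
  rewrite horner_prod big1 ?oner_eq0 // => j _.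
  by rewrite qint_horner0 // b0 // mem_tnth.
rewrite hornerM horner_prod big1 ?mulr1 => [|j _].
  by rewrite -polyC_natr hornerC pnatr_eq0 -lt0n.
by rewrite qint_horner0 // a0 // mem_tnth.
Qed.

(** At a root of [f] the left side vanishes, so z = 0 or some factor [qint (tnth a j)] vanishes at
    z; multiplying the latter by 1 - X gives z^(a_j) = 1. *)
Lemma balanced_roots f beta m (a b : m.-tuple nat) : 
  f.[1] != 0 -> {in a, forall x, 0 < x}%N ->
  balanced f beta a b ->
  forall z : R[i], root (map_poly intr f) z ->
    z = 0 \/ exists2 n : nat, (0 < n)%N & n.-unity_root z.
Proof.
move=> f1 a0 E z fz.
pose ev (p : {poly R}) := (map_poly (real_complex R) p).[z].
have evM p q : ev (p * q) = ev p * ev q by rewrite /ev rmorphM hornerM.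
have evpgf g : ev (pgf g) = real_complex R (g.[1])%:~R^-1 * (map_poly intr g).[z].
  rewrite /ev /pgf map_polyZ hornerZ -map_poly_comp; congr (_ * _.[z]).
  by apply: eq_map_poly => c /=; rewrite rmorph_int.
have := congr1 ev E; rewrite !evM evpgf (eqP fz) mulr0 mul0r.
move=> /esym /eqP; rewrite mulf_eq0 => /orP [].
  rewrite /ev map_polyXn hornerXn expf_eq0 => /andP [_ /eqP ->]; by left.
rewrite /ev rmorph_prod horner_prod => /prodf_eq0 [j _].
rewrite -/(ev _) evpgf mulf_eq0 fmorph_eq0 invr_eq0 intr_eq0 qint1.
have aj : (0 < tnth a j)%N by rewrite a0 // mem_tnth.
rewrite pnatr_eq0 gtn_eqF //= => qz; right; exists (tnth a j) => //.
have := congr1 (fun p : {poly int} => (map_poly intr p : {poly R[i]}).[z])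
  (qintE (tnth a j)).
rewrite rmorphM hornerM (eqP qz) mul0r rmorphB rmorph1 /= map_polyXn !hornerE.
by move=> /esym /eqP; rewrite subr_eq0 => /eqP zn; apply/unity_rootP.
Qed.

End PGF.

(** * The complex exponential *)

Section CircularFunctions.
Variable R : realType.

(** Reduce y modulo 2 pi to r in [0, 2 pi). Cosine is injective on [0, pi], which contains r or its
    reflection 2 pi - r; the reflected case would give r = 2 pi. *)
Lemma cos_eq1_nat (y : R) : 0 <= y -> cos y = 1 -> exists n : nat, y = pi *+ 2 *+ n.
Proof.
move=> y0 cy; have p0 := pi_gt0 R; have pp0 : 0 < pi *+ 2 :> R by rewrite pmulrn_rgt0.
pose n := Num.truncn (y / (pi *+ 2)).
have /andP [le_n lt_n] := truncn_itv (divr_ge0 y0 (ltW pp0)).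
rewrite -/n ler_pdivlMr // in le_n; rewrite -/n ltr_pdivrMr // in lt_n.
pose r := y - pi *+ 2 *+ n.
have rE : y = r + pi *+ 2 *+ n by rewrite subrK.
have r0 : 0 <= r by rewrite subr_ge0 -[_ *+ n]mulr_natl.
have r1 : r < pi *+ 2.
  by rewrite ltrBlDr -mulrS -[_ *+ n.+1]mulr_natl.
have cr : cos r = 1 by move: cy; rewrite rE (periodicn (@cosD2pi R)).
exists n; rewrite [LHS]rE; suff -> : r = 0 by rewrite add0r.
have [rp|pr] := leP r pi.
  by apply: cos_inj; rewrite ?in_itv /= ?r0 ?rp ?lexx ?ltW // cr cos0.
have cr' : cos (pi *+ 2 - r) = 1 by rewrite cosB cos2pi sin2pi cr mul1r mul0r addr0.
have : pi *+ 2 - r = 0.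
  apply: cos_inj; rewrite ?cr' ?cos0 // in_itv /=; last by rewrite lexx ltW.
  by rewrite subr_ge0 (ltW r1) /= lerBlDr mulr2n lerD2l ltW.
by move=> /eqP; rewrite subr_eq0 => /eqP rp; rewrite -rp ltxx in r1.
Qed.

Lemma cos_eq1 (y : R) : cos y = 1 -> exists n : int, y = n%:~R * (pi *+ 2).
Proof.
have [y0 /(cos_eq1_nat y0) [n ->]|/ltW y0] := leP 0 y.
  by exists n; rewrite -pmulrn mulr_natl.
rewrite -cosN => /cos_eq1_nat -/(_ _) []; first by rewrite oppr_ge0.
move=> n yE; exists (- n%:Z); rewrite rmorphN /= -pmulrn mulNr mulr_natl -yE.
by rewrite opprK.
Qed.

Lemma cexpD (z w : R[i]) : cexp (z + w) = cexp z * cexp w.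
Proof.
case: z w => [a b] [c e]; rewrite /cexp /= expRD cosD sinD.
by simpc; congr (_ +i* _); ring.
Qed.

Lemma cexp0 : cexp (0 : R[i]) = 1.
Proof. by rewrite /cexp /= expR0 cos0 sin0 mulr1 mulr0. Qed.

Lemma cexp_neq0 (z : R[i]) : cexp z != 0.
Proof.
apply/eqP => z0; have := cexpD z (- z); rewrite subrr cexp0 z0 mul0r.
by move=> /eqP; rewrite oner_eq0.
Qed.

Lemma cexpX (z : R[i]) (n : nat) : cexp (z * n%:R) = cexp z ^+ n.
Proof.
elim: n => [|n IH]; first by rewrite mulr0 cexp0.
by rewrite -natr1 mulrDr mulr1 cexpD IH exprSr.
Qed.

Lemma cexp_eq1 (z : R[i]) : cexp z = 1 ->
  complex.Re z = 0 /\ exists n : int, complex.Im z = n%:~R * (pi *+ 2).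
Proof.
case: z => a b /eqP; rewrite /cexp /= eq_complex /= => /andP [/eqP c1 /eqP].
have e0 := expR_gt0 a.
move=> /eqP; rewrite mulf_eq0 (gt_eqF e0) /= => /eqP s0.
have cb : cos b = 1.
  have := sin0cos1 s0; rewrite ger0_norm //.
  by rewrite -(pmulr_rge0 _ e0) c1 ler01.
split; last exact: cos_eq1.
by apply: expR_inj; rewrite expR0 -c1 cb mulr1.
Qed.

(** Polar coordinates: the arccosine of the normalized real part gives the angle up to a sign, which
    the imaginary part decides. *)
Lemma cexp_surj (z : R[i]) : z != 0 -> exists w, cexp w = z.
Proof.
case: z => a b; rewrite eq_complex /= => nz.
pose rho := Num.sqrt (a ^+ 2 + b ^+ 2).
have rho2 : 0 < a ^+ 2 + b ^+ 2.
  rewrite lt_def addr_ge0 ?sqr_ge0 // andbT paddr_eq0 ?sqr_ge0 //.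
  by rewrite !sqrf_eq0.
have rho0 : 0 < rho by rewrite sqrtr_gt0.
have rhoE : rho ^+ 2 = a ^+ 2 + b ^+ 2 by rewrite sqr_sqrtr // ltW.
pose c := a / rho; pose s := b / rho.
have cs : c ^+ 2 + s ^+ 2 = 1.
  by rewrite !expr_div_n -mulrDl -rhoE divff // expf_neq0 // gt_eqF.
have c1 : -1 <= c <= 1.
  rewrite -ler_norml -(@ler_pXn2r _ 2%N) // ?nnegrE // expr1n real_normK ?num_real //.
  by rewrite -cs lerDl sqr_ge0.
have sa : sin (acos c) = `|s|.
  by rewrite sin_acos // -cs [c ^+ 2 + _]addrC addrK sqrtr_sqr.
have [th [cth sth]] : exists th, cos th = c /\ sin th = s.
  have [s0|s0] := leP 0 s.
    exists (acos c); rewrite sa ger0_norm //; split=> //.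
    by rewrite acosK // in_itv.
  exists (- acos c); rewrite cosN sinN sa ltr0_norm // opprK; split=> //.
  by rewrite acosK // in_itv.
exists (ln rho +i* th); rewrite /cexp /= lnK ?posrE // cth sth /c /s.
by congr (_ +i* _); rewrite mulrC divfK // gt_eqF.
Qed.

End CircularFunctions.

(** * Zeros of the characteristic function *)

Section CharFun.
Variable R : realType.
Local Notation C := R[i].
Local Notation tau := (0 +i* (2 * pi) : C).

Lemma tau_neq0 : tau != 0.
Proof. by rewrite eq_complex /= eqxx /= mulf_neq0 ?pnatr_eq0 // gt_eqF // pi_gt0. Qed.

Lemma cexp_tauM_int (n : int) : cexp (tau * n%:~R) = 1.
Proof.
have nat1 (k : nat) : cexp (tau * k%:R) = 1.
  rewrite cexpX (_ : cexp tau = 1) ?expr1n // /cexp /= expR0 mulr_natl cos2pi sin2pi.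
  by rewrite mulr0 mulr1.
case: n => n; first exact: nat1.
by rewrite NegzE rmorphN /= mulrN -[LHS]mul1r -{1}(nat1 n.+1) -cexpD subrr cexp0.
Qed.

Lemma char_funE (Omega : finType) (X : Omega -> nat) (z : C) :
  char_fun X z = unif_expectation (fun w => cexp (tau * z) ^+ X w).
Proof.
by rewrite /char_fun /unif_expectation; under eq_bigr => w _ do rewrite cexpX.
Qed.

(** With z = x + iy, the exponent has real part -2 pi y n, which must be 0, and imaginary part 2 pi
    x n, which must be 2 pi k for an integer k; so z = k/n. *)
Lemma cexp_root_of_unity (z : C) (n : nat) : (0 < n)%N ->
  cexp (tau * z) ^+ n = 1 -> exists r : rat, z = ratr r.
Proof.
move=> n0; rewrite -cexpX => /cexp_eq1; case: z => x y.
have -> : tau * (x +i* y) * n%:R = (- (2 * pi * y * n%:R)) +i* (2 * pi * x * n%:R).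
  rewrite -[n%:R]/(n%:R : C) (_ : n%:R = n%:R +i* 0 :> C); last first.
    by apply/eqP; rewrite -[n%:R +i* 0]/(real_complex R n%:R) rmorph_nat.
  by simpc; congr (_ +i* _); ring.
have p0 : 2 * pi != 0 :> R by rewrite mulf_neq0 ?pnatr_eq0 // gt_eqF // pi_gt0.
have nn : n%:R != 0 :> R by rewrite pnatr_eq0 -lt0n.
move=> /= [/eqP]; rewrite oppr_eq0 !mulf_eq0 -!mulf_eq0.
rewrite mulf_eq0 (negbTE nn) orbF mulf_eq0 (negbTE p0) /= => /eqP -> [k E].
exists (k%:~R / n%:R).
rewrite fmorph_div rmorph_int rmorph_nat.
have -> : x = k%:~R / n%:R.
  apply: (mulIf nn); rewrite divfK //; apply: (mulIf p0).
  by rewrite [2 * pi in RHS]mulr_natl -E; ring.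
rewrite -[LHS]/(real_complex R _).
by rewrite fmorph_div /= rmorph_int rmorph_nat.
Qed.

(** The uniform space has one point for each unit of each coefficient, with the exponent as value;
    its cardinality is f(1). *)
Lemma multiset_space (f : {poly int}) : f != 0 -> (forall k, 0 <= f`_k) ->
  exists (Omega : finType) (X : Omega -> nat), (0 < #|Omega|)%N /\
    forall q : C, unif_expectation (fun w => q ^+ X w) =
      (map_poly intr f).[q] / (map_poly intr f).[1].
Proof.
move=> f0 fge; pose Omega : finType := {k : 'I_(size f) & 'I_(absz f`_k)}.
pose X (w : Omega) : nat := tag w.
have sumX (q : C) : \sum_(w : Omega) q ^+ X w = (map_poly intr f).[q].
  rewrite -(sig_big_dep xpredT (fun _ => xpredT) (fun (k : 'I_(size f)) _ => q ^+ k)) /=.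
  rewrite (horner_coef_wide _ (size_poly _ _)); apply: eq_bigr => k _.
  rewrite sumr_const card_ord coef_map /= -mulr_natl; congr (_ * _).
  by rewrite -[in RHS](gez0_abs (fge k)).
have cardE : #|Omega|%:R = (map_poly intr f).[1] :> C.
  rewrite -sumX -sum1_card natr_sum; apply: eq_bigr => w _.
  by rewrite expr1n.
exists Omega, X; split=> [|q]; last by rewrite /unif_expectation sumX cardE.
rewrite lt0n -(pnatr_eq0 C) cardE -(rmorph1 (intr : int -> C)) horner_map /=.
by rewrite intr_eq0 gt_eqF // coef_sum_gt0.
Qed.

End CharFun.

(** * The two sides of (v) as sums over blocks of one independent family *)

Lemma join_family_inl (m : nat) (K : Type) (idx : K) (op : Monoid.com_law idx)
    (x : K) (u v : 'I_m -> K) :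
  \big[op/idx]_(s in [set Some (inl j) | j : 'I_m]%SET) join_family x u v s =
  \big[op/idx]_(j < m) u j.
Proof. by rewrite big_imset //= => i j _ _ []. Qed.

Lemma join_family_None_inr (m : nat) (K : Type) (idx : K) (op : Monoid.com_law idx)
    (x : K) (u v : 'I_m -> K) :
  \big[op/idx]_(s in (None |: [set Some (inr j) | j : 'I_m])%SET) join_family x u v s =
  op x (\big[op/idx]_(j < m) v j).
Proof.
rewrite big_setU1 /=; last by apply/imsetP => -[j].
by rewrite big_imset //= => i j _ _ [].
Qed.

Lemma join_family_app (m : nat) (A B : Type) (g : A -> B) (x : A) (u v : 'I_m -> A) s :
  g (join_family x u v s) =
  join_family (g x) (fun j => g (u j)) (fun j => g (v j)) s.
Proof. by case: s => [[]|]. Qed.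

Section Laws.
Context (R : realType) (f : {poly int}) (beta m : nat) (a b : m.-tuple nat).
Context (d : measure_display) (T : measurableType d) (P : probability T R).
Context (X : {RV P >-> nat}) (Ua Ub : 'I_m -> {RV P >-> nat}).
Hypothesis lawX : forall k : nat,
  P (X @^-1` [set k]) = ((f`_k)%:~R / (f.[1])%:~R : R)%:E.
Hypothesis lawa : forall j : 'I_m, uniformly_distributed (tnth a j) (Ua j).
Hypothesis lawb : forall j : 'I_m, uniformly_distributed (tnth b j) (Ub j).
Hypothesis indep : mutually_independent (join_family X Ua Ub).

Let G := join_family (pgf R f) (fun j => pgf R (qint (tnth a j)))
  (fun j => pgf R (qint (tnth b j))).

Let lawY s k : P (join_family X Ua Ub s @^-1` [set k]) = ((G s)`_k)%:E.
Proof.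
case: s => [[j|j]|]; rewrite /G /=.
- by rewrite lawa coef_pgf_qint.
- by rewrite lawb coef_pgf_qint.
by rewrite lawX coef_pgf.
Qed.

Let left_sum w : (X w + \sum_(j < m) Ub j w)%N =
  (\sum_(s in (None |: [set Some (inr j) | j : 'I_m])%SET) join_family X Ua Ub s w)%N.
Proof.
rewrite -(join_family_None_inr _ (X w) (fun j => Ua j w)).
by apply: eq_bigr => s _; rewrite (join_family_app (fun Z : {RV P >-> nat} => Z w)).
Qed.

Let right_sum w : (\sum_(j < m) Ua j w)%N =
  (\sum_(s in [set Some (inl j) | j : 'I_m]%SET) join_family X Ua Ub s w)%N.
Proof.
rewrite -(join_family_inl _ (X w) _ (fun j => Ub j w)).
by apply: eq_bigr => s _; rewrite (join_family_app (fun Z : {RV P >-> nat} => Z w)).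
Qed.

Let left_law k : P [set w | (X w + \sum_(j < m) Ub j w)%N = k] =
  ((pgf R f * \prod_(j < m) pgf R (qint (tnth b j)))`_k)%:E.
Proof.
under eq_set => w do rewrite left_sum.
rewrite (sum_independent_law _ _ indep lawY).
by rewrite /G join_family_None_inr.
Qed.

(** Subtraction in [nat] truncates, so k < beta, where the event is empty, is set apart; [coefXnM]
    makes the same distinction. *)
Let right_setE k : [set w | (beta + \sum_(j < m) Ua j w)%N = k] =
  if (k < beta)%N then set0 else
  [set w | (\sum_(s in [set Some (inl j) | j : 'I_m]%SET)
     join_family X Ua Ub s w)%N = (k - beta)%N].
Proof.
apply/seteqP; case: ltnP => [lt|le]; split=> w //=.
- by move=> E; move: lt; rewrite -E ltnNge leq_addr.
- by rewrite -right_sum => <-; rewrite addKn.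
- by rewrite -right_sum => ->; rewrite subnKC.
Qed.

Let right_law k : P [set w | (beta + \sum_(j < m) Ua j w)%N = k] =
  (('X^beta * \prod_(j < m) pgf R (qint (tnth a j)))`_k)%:E.
Proof.
rewrite right_setE coefXnM; case: ifP => _; first by rewrite measure0.
by rewrite (sum_independent_law _ _ indep lawY) /G join_family_inl.
Qed.

(** The point masses of the two sums are the coefficients of the two sides of [balanced], and they
    determine the laws. *)
Lemma sum_distribution_eqP :
  pushforward P (fun w => X w + \sum_(j < m) Ub j w)%N =
  pushforward P (fun w => beta + \sum_(j < m) Ua j w)%N <->
  balanced R f beta a b.
Proof.
split=> [E|E].
  apply/polyP => k; have := congr1 (fun mu => mu [set k]) E.
  by rewrite /pushforward /preimage /= left_law right_law => -[].
apply: pushforward_nat_eq => k.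
- under eq_set => w do rewrite left_sum.
  exact: measurable_sum_eq.
- rewrite right_setE; case: ifP => _; first exact: measurable0.
  exact: measurable_sum_eq.
by rewrite left_law right_law E.
Qed.
End Laws.

(** * Existence of the independent variables in (v) *)

Section Coupling.
Context (R : realType) (f : {poly int}) (m : nat) (a b : m.-tuple nat).
Hypothesis f_neq0 : f != 0.
Hypothesis f_ge0 : forall k : nat, 0 <= f`_k.
Hypothesis a_gt0 : {in a, forall x, 0 < x}%N.
Hypothesis b_gt0 : {in b, forall x, 0 < x}%N.

(** Each [pgf] involved has nonnegative coefficients with sum 1, hence defines a law; the
    coordinates of the finite product space realize these laws independently. *)
Lemma independent_coupling :
  exists (d : measure_display) (T : measurableType d)
    (P : probability T R) (X : {RV P >-> nat}) (Ua Ub : 'I_m -> {RV P >-> nat}),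
  [/\ forall k : nat,
        P (X @^-1` [set k]) = ((f`_k)%:~R / (f.[1])%:~R : R)%:E,
      forall j : 'I_m, uniformly_distributed (tnth a j) (Ua j),
      forall j : 'I_m, uniformly_distributed (tnth b j) (Ub j)
    & mutually_independent (join_family X Ua Ub)].
Proof.
pose G := join_family f (fun j => qint (tnth a j)) (fun j => qint (tnth b j)).
have G_ge0 s k : 0 <= (G s)`_k.
  by case: s => [[j|j]|] //=; rewrite coef_qint ler0n.
have G_neq0 s : G s != 0.
  case: s => [[j|j]|] //=; apply: qint_neq0.
    by rewrite a_gt0 ?mem_tnth.
  by rewrite b_gt0 ?mem_tnth.
have G1 s : 0 < (G s).[1] by apply: coef_sum_gt0.
pose p s k := (pgf R (G s))`_k.
have p_ge0 s k : 0 <= p s k.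
  by rewrite /p coef_pgf divr_ge0 // ler0z // ltW.
(* One bound on all degrees, so that every law lives on the same finite range. *)
pose N := (\sum_s size (pgf R (G s)))%N.
have szN s : (size (pgf R (G s)) <= N)%N by rewrite /N (bigD1 s) //= leq_addr.
have p_sum1 s : \sum_(j < N.+1) p s j = 1.
  rewrite -(pgf1 R (lt0r_neq0 (G1 s))) (horner_coef_wide _ (leqW (szN s))).
  by apply: eq_bigr => j _; rewrite expr1n mulr1.
have law s k :
    product_prob N p_ge0 (coordinate_rv p_ge0 p_sum1 s @^-1` [set k]) = (p s k)%:E.
  apply: coordinate_law => j Nj; rewrite /p nth_default //.
  by rewrite (leq_trans (szN s)) // ltnW.
pose Y := coordinate_rv p_ge0 p_sum1.
exists default_measure_display, nat, (product_prob N p_ge0), (Y None),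
  (fun j => Y (Some (inl j))), (fun j => Y (Some (inr j))).
split=> [k|j k|j k|].
- by apply: (etrans (law None k)); rewrite /p coef_pgf.
- by apply: (etrans (law (Some (inl j)) k)); rewrite /p coef_pgf_qint.
- by apply: (etrans (law (Some (inr j)) k)); rewrite /p coef_pgf_qint.
rewrite (_ : join_family _ _ _ = Y); first exact: coordinate_independent.
by apply/funext => -[[]|].
Qed.
End Coupling.

(** * The cycle of implications and uniqueness *)

Lemma map_intr_root1 (C : numClosedFieldType) (f : {poly int}) :
  (map_poly intr f : {poly C}).[1] = (f.[1])%:~R.
Proof. by rewrite -[1 in LHS](rmorph1 (intr : int -> C)) horner_map. Qed.

Lemma ratr_mul_denq (F : numFieldType) (r : rat) :
  ratr r * (absz (denq r))%:R = (numq r)%:~R :> F.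
Proof.
have -> : (absz (denq r))%:R = (denq r)%:~R :> F by rewrite -[in RHS]absz_denq.
by rewrite -(ratr_int _ (denq r)) -rmorphM /= -numqE ratr_int.
Qed.

Theorem mainTheorem1 (R : realType) (f : {poly int})
    (f_neq0 : f != 0) (f_ge0 : forall k : nat, 0 <= f`_k) :
  let fC : {poly R[i]} := map_poly intr f in
  [<->
    (* (i) *)
    forall z : R[i], root fC z ->
      z = 0 \/ (exists2 n : nat, (0 < n)%N & n.-unity_root z);
    (* (ii) *)
    (forall z : R[i], root fC z -> `|z| <= 1) /\
      lead_coef f = (\big[gcdn/0%N]_(k < size f) `|(f`_k)%R|%N)%:Z;
    (* (iii) *)
    exists (alpha beta : nat) (s : seq nat),
      [/\ (0 < alpha)%N, {in s, forall n, 0 < n}%N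
        & f = alpha%:R * 'X^beta * \prod_(n <- s) 'Phi_n];
    (* (iv) *)
    exists (alpha beta m : nat) (a b : m.-tuple nat),
      qint_factorization f alpha beta a b;
    (* (v) *)
    exists beta : nat, largest_X_power f beta /\
      exists (m : nat) (a b : m.-tuple nat),
      [/\ {in a, forall x, 0 < x}%N, {in b, forall x, 0 < x}%N
        & exists (d : measure_display) (T : measurableType d)
            (P : probability T R) (X : {RV P >-> nat})
            (Ua Ub : 'I_m -> {RV P >-> nat}),
          [/\ forall k : nat,
                P (X @^-1` [set k]) = ((f`_k)%:~R / (f.[1])%:~R : R)%:E,
              forall j : 'I_m, uniformly_distributed (tnth a j) (Ua j),
              forall j : 'I_m, uniformly_distributed (tnth b j) (Ub j),
              mutually_independent (join_family X Ua Ub)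
            & pushforward P (fun w => X w + \sum_(j < m) Ub j w)%N =
              pushforward P (fun w => beta + \sum_(j < m) Ua j w)%N]];
    (* (vi) *)
    exists (Omega : finType) (X : Omega -> nat),
      [/\ (0 < #|Omega|)%N,
          forall q : R[i],
            unif_expectation (fun w => q ^+ X w) = fC.[q] / fC.[1]
        & forall z : R[i], char_fun X z = 0 -> exists r : rat, z = ratr r] ]
  /\ (* uniqueness in (iv) for disjoint multisets, and existence *)
  (forall (alpha beta m alpha' beta' m' : nat)
      (a b : m.-tuple nat) (a' b' : m'.-tuple nat),
    qint_factorization f alpha beta a b -> disjoint_multisets a b ->
    qint_factorization f alpha' beta' a' b' -> disjoint_multisets a' b' ->
    [/\ alpha = alpha', beta = beta', perm_eq a a' & perm_eq b b'])
  /\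
  ((exists (alpha beta m : nat) (a b : m.-tuple nat),
      qint_factorization f alpha beta a b) ->
   exists (alpha beta m : nat) (a b : m.-tuple nat),
      qint_factorization f alpha beta a b /\ disjoint_multisets a b).
Proof.
move=> fC; have f1 : 0 < f.[1] by exact: coef_sum_gt0.
have tuples (a b : seq nat) alpha beta : size a = size b ->
    q_factorization f alpha beta a b ->
    exists m (a' b' : m.-tuple nat), [/\ a' = a :> seq nat, b' = b :> seq nat &
      qint_factorization f alpha beta a' b'].
  move=> /esym/eqP sz fac; exists (size a), (in_tuple a), (Tuple sz).
  by split=> //; apply/qint_factorizationP.
split; last split.
- tfae.
  (* The constant of the cyclotomic factorization is the leading coefficient, hence nonnegative; as
     its cofactor is monic, it is also the content. *)
  + move=> roots; split.
      move=> z /roots [->|[n n0 /unity_rootP zn]]; first by rewrite normr0 ler01.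
      by rewrite -(expr_le1 n0 (normr_ge0 z)) -normrX zn normr1.
    have [c [beta [s [s0 fE]]]] := cyclotomic_factorization f_neq0 roots.
    have lc : lead_coef f = c.
      rewrite fE -mulrA lead_coefM lead_coefC.
      by rewrite (monicP (prod_Cyclotomic_monic beta s)) mulr1.
    have c0 : 0 <= c by rewrite -lc lead_coefE f_ge0.
    rewrite lc -[in LHS](gez0_abs c0); congr (Posz _); rewrite -/(coef_gcd f).
    rewrite fE -mulrA -(gez0_abs c0) -[X in X%:P]natz polyC_natr.
    by rewrite coef_gcd_monic // prod_Cyclotomic_monic.
  (* Kronecker's theorem needs a monic polynomial: it is applied to [f] divided by its content,
     which has the same roots. *)
  + move=> [disk lc].
    have [g mg fE] := lead_coef_coef_gcd f_neq0 lc.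
    set c := coef_gcd f in fE.
    have c0 : (0 < c)%N.
      by rewrite lt0n; apply: contraNneq f_neq0 => c0; rewrite fE c0 mul0r.
    have rootE (z : R[i]) : root fC z = root (map_poly intr g) z.
      rewrite /fC fE rmorphM /= rmorph_nat -polyC_natr mul_polyC rootZ //.
      by rewrite pnatr_eq0 -lt0n.
    have [|c' [beta [s [s0 gE]]]] := @cyclotomic_factorization R[i] g (monic_neq0 mg).
      move=> z gz; have [->|z0] := eqVneq z 0; [by left|right].
      by apply: (kronecker mg) => // x; rewrite -rootE; apply: disk.
    have c'1 : c' = 1.
      have := monicP mg; rewrite gE -mulrA lead_coefM lead_coefC.
      by rewrite (monicP (prod_Cyclotomic_monic beta s)) mulr1.
    by exists c, beta, s; split=> //; rewrite fE gE c'1 mul1r mulrA.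
  + move=> [alpha [beta [s [al0 s0 fE]]]].
    have [a [b [sz fac]]] := q_factorization_Cyclotomic (lt0r_neq0 f1) al0 s0 fE.
    have [m [a' [b' [_ _ h]]]] := tuples a b _ _ sz fac.
    by exists alpha, beta, m, a', b'.
  + move=> [alpha [beta [m [a [b /qint_factorizationP fac]]]]].
    have [al0 a0 b0 _] := fac.
    exists beta; split; first exact: q_factorization_largest fac.
    exists m, a, b; split=> //.
    have [d [T [P [X [Ua [Ub [lX la lb ind]]]]]]] :=
      independent_coupling R f_neq0 f_ge0 a0 b0.
    exists d, T, P, X, Ua, Ub; split=> //.
    apply/(sum_distribution_eqP beta lX la lb ind).
    exact: q_factorization_balanced fac.
  (* A zero z of the characteristic function makes e^(2 i pi z) a root of [f]. It is nonzero, hence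
     a root of unity, and z is rational. *)
  + move=> [beta [_ [m [a [b [a0 b0 [d [T [P [X [Ua [Ub [lX la lb ind]]]]]]]]]]]]].
    move=> /(sum_distribution_eqP beta lX la lb ind) bal.
    have roots := balanced_roots (lt0r_neq0 f1) a0 bal.
    have [W [Y [W0 EY]]] := multiset_space R f_neq0 f_ge0.
    exists W, Y; split=> // z; rewrite char_funE EY => /eqP.
    rewrite mulf_eq0 invr_eq0 map_intr_root1 intr_eq0 (gt_eqF f1) orbF => /roots [].
      by move=> /eqP; rewrite (negbTE (cexp_neq0 _)).
    by move=> [n n0 /unity_rootP]; apply: cexp_root_of_unity.
  (* Writing a nonzero root as e^(2 i pi t) makes t a zero of the characteristic function, hence
     rational; its denominator is an exponent that takes the root to 1. *)
  move=> [W [X [_ EX Xq]]] z fz; have [->|z0] := eqVneq z 0; [by left|right].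
  have [w wE] := cexp_surj z0.
  pose t := w / (0 +i* (2 * pi)).
  have tE : (0 +i* (2 * pi)) * t = w by rewrite mulrC divfK // tau_neq0.
  have [|r tr] := Xq t.
    by rewrite char_funE tE wE EX (eqP fz) mul0r.
  exists (absz (denq r)); first by rewrite absz_gt0 denq_neq0.
  apply/unity_rootP; rewrite -wE -cexpX -tE -mulrA.
  apply: (etrans _ (cexp_tauM_int R (numq r))).
  by rewrite tr ratr_mul_denq.
- move=> alpha beta m alpha' beta' m' a b a' b' /qint_factorizationP h d
    /qint_factorizationP h' d'.
  exact: (q_factorization_uniq h d h' d').
move=> [alpha [beta [m [a [b /qint_factorizationP fac]]]]].
have [|a' [b' [fac' sz dis]]] := q_factorization_disjoint fac.
  by rewrite !size_tuple.
have [m' [a2 [b2 [aE bE h]]]] := tuples _ _ _ _ sz fac'.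
exists alpha, beta, m', a2, b2; split=> //.
by rewrite /disjoint_multisets aE bE.
Qed.
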